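(* For all $k,t\in\mathbb{N}$, every graph $G$ that contains the $(t(2k+1)\times t(2k+1))$-grid as a minor contains the $(k\times k)$-grid as an induced minor or contains $K_t$ as a minor.
   Context: $\mathbb{N}$ denotes the non-negative integers. The $(m\times n)$-grid has vertex set $[m]\times[n]$, with $(v_1,v_2)$ and $(u_1,u_2)$ adjacent iff either $v_1=u_1$ and $|v_2-u_2|=1$, or $v_2=u_2$ and $|v_1-u_1|=1$. A graph $H$ is an induced minor of $G$ if a graph isomorphic to $H$ can be obtained from $G$ by deleting vertices and contracting edges. *)

(* Defs.v *)
From mathcomp Require Import all_boot ssrint.

Set Implicit Arguments.
Unset Strict Implicit.
Unset Printing Implicit Defensive.

(* Finite simple graphs; the graph without vertices is allowed. *)
Record sgraph := SGraph {
  vert :> finType;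
  adj : rel vert;
  adj_sym : symmetric adj;
  adj_irr : irreflexive adj }.

Definition iso (G H : sgraph) : Prop :=
  exists2 f : G -> H, bijective f & {mono f : u v / adj u v}.

Section Operations.
Variables (G : sgraph) (x y : G).

Definition del_vertex_rel : rel {u : G | u != x} :=
  fun u v => adj (val u) (val v).
Fact del_vertex_sym : symmetric del_vertex_rel.
Proof. by move=> u v; apply: adj_sym. Qed.
Fact del_vertex_irr : irreflexive del_vertex_rel.
Proof. by move=> u; apply: adj_irr. Qed.
Definition del_vertex : sgraph := SGraph del_vertex_sym del_vertex_irr.

Definition del_edge_rel : rel G :=
  fun u v => adj u v && ([set u; v] != [set x; y]).
Fact del_edge_sym : symmetric del_edge_rel.
Proof. by move=> u v; rewrite /del_edge_rel adj_sym setUC. Qed.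
Fact del_edge_irr : irreflexive del_edge_rel.
Proof. by move=> u; rewrite /del_edge_rel adj_irr. Qed.
Definition del_edge : sgraph := SGraph del_edge_sym del_edge_irr.

(* The vertex y is merged into x; loops and parallel edges are discarded.
   Meaningful only when x and y are adjacent. *)
Definition contract_rel : rel {u : G | u != y} := fun u v =>
  (u != v) && [|| adj (val u) (val v),
                  (val u == x) && adj y (val v)
                | (val v == x) && adj y (val u)].
Fact contract_sym : symmetric contract_rel.
Proof.
by move=> u v; rewrite /contract_rel eq_sym adj_sym [X in _ || X]orbC.
Qed.
Fact contract_irr : irreflexive contract_rel.
Proof. by move=> u; rewrite /contract_rel eqxx. Qed.
Definition contract : sgraph := SGraph contract_sym contract_irr.

End Operations.

(* The graph of which H is a minor comes last: [minor H G] reads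
   "H is a minor of G". *)
Inductive minor (H : sgraph) : sgraph -> Prop :=
| minor_iso (G : sgraph) : iso G H -> minor H G
| minor_del_vertex (G : sgraph) (x : G) :
    minor H (del_vertex x) -> minor H G
| minor_del_edge (G : sgraph) (x y : G) :
    adj x y -> minor H (del_edge x y) -> minor H G
| minor_contract (G : sgraph) (x y : G) :
    adj x y -> minor H (contract x y) -> minor H G.

Inductive induced_minor (H : sgraph) : sgraph -> Prop :=
| induced_minor_iso (G : sgraph) : iso G H -> induced_minor H G
| induced_minor_del_vertex (G : sgraph) (x : G) :
    induced_minor H (del_vertex x) -> induced_minor H G
| induced_minor_contract (G : sgraph) (x y : G) :
    adj x y -> induced_minor H (contract x y) -> induced_minor H G.

(* Vertices are numbered from 0; `|a - b|%N is the distance of a and b as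
   integers, not a truncated difference. *)
Definition grid_rel (m n : nat) : rel ('I_m * 'I_n) := fun v u =>
  (v.1 == u.1) && (`|v.2 - u.2|%N == 1)
  || (v.2 == u.2) && (`|v.1 - u.1|%N == 1).
Fact grid_sym (m n : nat) : symmetric (@grid_rel m n).
Proof.
by move=> v u; rewrite /grid_rel (eq_sym u.1) (eq_sym u.2)
  (distnC u.1) (distnC u.2).
Qed.
Fact grid_irr (m n : nat) : irreflexive (@grid_rel m n).
Proof. by move=> v; rewrite /grid_rel !distnn !andbF. Qed.
Definition grid (m n : nat) : sgraph := SGraph (@grid_sym m n) (@grid_irr m n).

Definition complete_rel (t : nat) : rel 'I_t := fun u v => u != v.
Fact complete_sym (t : nat) : symmetric (@complete_rel t).
Proof. by move=> u v; rewrite /complete_rel eq_sym. Qed.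
Fact complete_irr (t : nat) : irreflexive (@complete_rel t).
Proof. by move=> u; rewrite /complete_rel eqxx. Qed.
Definition complete (t : nat) : sgraph :=
  SGraph (@complete_sym t) (@complete_irr t).

(* Main.v *)
(** Contract a model of the big grid to get a graph Q on [n] x [n], n = t(2k+1),
    that contains the grid, and cut [n] x [n] into t x t blocks of side 2k+1.
    Call an edge uv of Q with both ends in the interior of a block a jump if its
    ends differ by at least 2 in one coordinate, say the column.  A jump lets a
    left-right and a top-bottom connection of the block cross without meeting:
    the first follows the row of u, the edge uv and the row of v, the second
    follows the column just after that of u, and the margin of the block is used
    to align both with the middles of the sides.  If every block has a jump, the
    union of the horizontal connections of the i-th strip of rows and the
    vertical connections of the i-th strip of columns is a branch set of a K_t
    model.  In the interior of a block without jumps, delete the cells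
    whose two local coordinates are even and contract alternately vertical and
    horizontal 3-paths centred at the cells with two odd coordinates: this is a
    k x k grid, and edges inside unit squares create no further adjacency. *)
Require Import Defs.
From mathcomp Require Import all_boot.
From mathcomp Require Import zify.

Set Implicit Arguments.
Unset Strict Implicit.
Unset Printing Implicit Defensive.

(** * Connected sets, packings and models *)

(* Connectedness, without paths: a locally constant predicate is constant. *)
Definition conn (G : sgraph) (S : {set G}) : Prop :=
  forall P : pred G, {in S &, forall x y, adj x y -> P x = P y} ->
  {in S &, forall x y, P x = P y}.

Definition touch (G : sgraph) (A C : {set G}) : bool :=
  [exists x in A, exists y in C, adj x y].

Lemma touchP (G : sgraph) (A C : {set G}) :
  reflect (exists x y, [/\ x \in A, y \in C & adj x y]) (touch A C).
Proof.
apply: (iffP exists_inP) => [[x xA /exists_inP[y yC xy]]|[x [y [xA yC xy]]]].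
  by exists x, y.
by exists x => //; apply/exists_inP; exists y.
Qed.

Lemma touch_sym (G : sgraph) (A C : {set G}) : touch A C = touch C A.
Proof.
by apply/touchP/touchP => -[x [y [xA yC xy]]]; exists y, x; rewrite adj_sym.
Qed.

Record packing (T : Type) (G : sgraph) (B : T -> {set G}) : Prop := Packing {
  packing_neq0 : forall h, exists x, x \in B h;
  packing_conn : forall h, conn (B h);
  packing_inj : forall h h' x, x \in B h -> x \in B h' -> h = h' }.

(** Equal indices are excluded because a branch set with an inner edge touches itself, whereas [adj]
    is irreflexive. *)
Record imodel (H G : sgraph) (B : H -> {set G}) : Prop := IModel {
  imodel_packing : packing B;
  imodel_adj : forall h h', h != h' -> adj h h' = touch (B h) (B h') }.

Lemma conn1 (G : sgraph) (x : G) : conn [set x].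
Proof. by move=> P _ u v /set1P-> /set1P->. Qed.

(** * Edge contraction; minors versus models *)

Section Contract.
Variables (G : sgraph) (x y : G) (xy : adj x y).

Fact contract_neq : x != y.
Proof. by apply: contraTneq xy => ->; rewrite adj_irr. Qed.

(** The default value of [insubd] is taken at [y] only, so this is the quotient map merging [y] into
    [x]. *)
Definition contract_proj : G -> contract x y :=
  insubd (exist (fun u => u != y) x contract_neq).

Lemma contract_projK (u : contract x y) : contract_proj (val u) = u.
Proof. exact: valKd. Qed.

Lemma val_contract_proj u : val (contract_proj u) = if u == y then x else u.
Proof. by rewrite val_insubd; case: eqP. Qed.

Lemma contract_proj_xy : contract_proj y = contract_proj x.
Proof.
by apply: val_inj; rewrite !val_contract_proj eqxx (negPf contract_neq).
Qed.

Lemma contract_proj_adj u v : adj u v ->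
  contract_proj u = contract_proj v \/ adj (contract_proj u) (contract_proj v).
Proof.
move=> uv; case: (eqVneq (contract_proj u) (contract_proj v)) => e.
  by left.
right; rewrite /adj /= /contract_rel e /=; rewrite !val_contract_proj.
move: uv; case: (eqVneq u y) => [->|uy]; case: (eqVneq v y) => [->|vy];
  rewrite ?adj_irr ?eqxx //.
- by move=> ->; rewrite orbT.
- by rewrite adj_sym => ->; rewrite !orbT.
- by move=> ->.
Qed.

Lemma contract_adjE (u v : contract x y) : adj u v ->
  exists u' v', [/\ contract_proj u' = u, contract_proj v' = v & adj u' v'].
Proof.
case/andP=> _ /or3P[uv|/andP[/eqP ux yv]|/andP[/eqP vx yu]].
- by exists (val u), (val v); rewrite !contract_projK.
- exists y, (val v); split; rewrite ?contract_projK //.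
  by rewrite contract_proj_xy -ux contract_projK.
- exists (val u), y; split; rewrite ?contract_projK // 1?adj_sym //.
  by rewrite contract_proj_xy -vx contract_projK.
Qed.

(** The preimage contains both [x] and [y] or neither. In the first case the edge between them
    forces equal values of a locally constant predicate, which therefore descends to the
    contraction. *)
Lemma conn_contract (S : {set contract x y}) :
  conn S <-> conn (contract_proj @^-1: S).
Proof.
split=> cS P loc.
  have Pval u : u \in contract_proj @^-1: S -> P u = P (val (contract_proj u)).
    rewrite inE val_contract_proj; case: (eqVneq u y) => // -> yS.
    by apply: loc; rewrite ?inE -?contract_proj_xy // adj_sym.
  move=> u v uS vS; rewrite (Pval u) // (Pval v) //.
  apply: (cS (P \o val)); try by move: uS vS; rewrite !inE.
  move=> {u v uS vS} u v uS vS /contract_adjE[u' [v' [eu ev uv]]] /=.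
  rewrite -eu -ev -!Pval ?inE ?eu ?ev //.
  by apply: loc; rewrite ?inE ?eu ?ev.
move=> u v uS vS.
rewrite -(contract_projK u) -(contract_projK v).
apply: (cS (P \o contract_proj)); rewrite ?inE ?contract_projK //.
move=> {u v uS vS} u v; rewrite !inE => uS vS /contract_proj_adj /=.
by case=> [->|] //; apply: loc.
Qed.

End Contract.

(** Branch sets are carried back along each operation. Edge deletion leaves them unchanged but may
    hide an edge between them, so only one direction of adjacency survives. *)
Lemma minor_packing (H G : sgraph) : minor H G ->
  exists2 B : H -> {set G}, packing B &
    forall h h', adj h h' -> touch (B h) (B h').
Proof.
elim=> {G} [G [f [g fK gK] fM]|G x _ [B [B0 Bc Bi] Be]|
            G x y xy _ [B [B0 Bc Bi] Be]|G x y xy _ [B [B0 Bc Bi] Be]].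
- exists (fun h => [set g h]).
    split=> [h|h|h h' x]; first by exists (g h); rewrite inE.
      exact: conn1.
    by rewrite !inE => /eqP-> /eqP /(can_inj gK).
  move=> h h' hh; apply/touchP; exists (g h), (g h').
  by rewrite !inE -fM !gK.
- exists (fun h => [set val u | u in B h]).
    split=> [h|h P loc|h h' u].
    + by have [u uB] := B0 h; exists (val u); apply: imset_f.
    + move=> _ _ /imsetP[u uB ->] /imsetP[v vB ->].
      apply: (Bc h (P \o val)) => // {u uB v vB} u v uB vB uv /=.
      by apply: loc => //; apply: imset_f.
    + case/imsetP=> v vB -> /imsetP[w wB] /val_inj vw.
      by apply: Bi vB _; rewrite vw.
  move=> h h' /Be /touchP[u [v [uB vB uv]]]; apply/touchP.
  by exists (val u), (val v); split => //; apply: imset_f.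
- exists B.
    split=> // h P loc; apply: (Bc h) => u v uB vB /andP[uv _].
    exact: loc.
  move=> h h' /Be /touchP[u [v [uB vB /andP[uv _]]]].
  by apply/touchP; exists u, v.
- exists (fun h => contract_proj xy @^-1: B h).
    split=> [h|h|h h' u].
    + by have [u uB] := B0 h; exists (val u); rewrite inE contract_projK.
    + by apply/conn_contract.
    + by rewrite !inE; apply: Bi.
  move=> h h' /Be /touchP[u [v [uB vB /(contract_adjE xy)]]].
  by case=> u' [v' [eu ev uv]]; apply/touchP; exists u', v'; rewrite !inE eu ev.
Qed.

Lemma card_del (T : finType) (x : T) : #|{: {u : T | u != x}}| < #|T|.
Proof.
rewrite card_sig; apply: proper_card; apply/properP; split; first exact/subsetP.
by exists x; rewrite // inE eqxx.
Qed.

(** Induction on the number of vertices: a vertex outside all branch sets is deleted; otherwise an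
    edge inside a branch set is contracted. If neither exists, connectedness makes every branch set
    a singleton and the model is an isomorphism. *)
Lemma imodel_induced_minor (H G : sgraph) (B : H -> {set G}) :
  imodel B -> induced_minor H G.
Proof.
have [n] := ubnP #|G|; elim: n G B => // n IH G B /ltnSE leGn.
case=> -[B0 Bc Bi] Ba.
case: (pickP (fun x => [forall h, x \notin B h])) => [x /forallP xB|cov].
  have vB h u : u \in B h ->
      exists2 v : del_vertex x, v \in val @^-1: B h & val v = u.
    move=> uB; have ux : u != x by apply: contraTneq uB => ->.
    by exists (exist (fun w => w != x) u ux); rewrite ?inE.
  apply: (@induced_minor_del_vertex _ _ x).
  apply: (IH (del_vertex x) (fun h => val @^-1: B h)).
    exact: leq_trans (card_del x) _.
  split; first split=> [h|h P loc u v|h h' u].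
  - by have [u /vB[v vBh _]] := B0 h; exists v.
  - rewrite !inE => uB vBh.
    (* [P] is extended by [false] to the deleted vertex, which no branch set contains. *)
    have := Bc h (fun w => if insub w is Some w' then P w' else false).
    move=> /(_ _ (val u) (val v) uB vBh); rewrite !valK; apply.
    move=> _ _ /vB[a aB <-] /vB[b bB <-] ab.
    by rewrite !valK; apply: loc.
  - by rewrite !inE; apply: Bi.
  - move=> h h' hh; rewrite (Ba _ _ hh); apply/idP/idP => /touchP.
      case=> a [b [/vB[u uB eu] /vB[v vBh ev] uv]].
      by apply/touchP; exists u, v; split=> //; rewrite -eu -ev in uv.
    case=> u [v [uB vBh uv]].
    by apply/touchP; exists (val u), (val v); rewrite !inE in uB vBh.
have {}cov x : exists h, x \in B h.
  have /negbT := cov x; rewrite negb_forall => /existsP[h].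
  by rewrite negbK; exists h.
case: (pickP (fun p : G * G =>
   adj p.1 p.2 && [exists h, (p.1 \in B h) && (p.2 \in B h)]))
  => [[x y]|noe] /=.
  case/andP=> xy /existsP[h0 /andP[xB yB]].
  apply: (induced_minor_contract xy).
  (* Both ends of the contracted edge lie in [B h0], so each branch set is a union of fibres of the
     projection. *)
  have preB h : contract_proj xy @^-1: (val @^-1: B h) = B h.
    apply/setP=> u; rewrite !inE val_contract_proj.
    case: eqP => // ->; apply/idP/idP => [/(Bi _ _ _ xB) <- //|].
    by move/(Bi _ _ _ yB) <-.
  have memB h u : (u \in B h) = (val (contract_proj xy u) \in B h).
    by rewrite -{1}(preB h) !inE.
  apply: (IH (contract x y) (fun h => val @^-1: B h)).
    exact: leq_trans (card_del y) _.
  split; first split=> [h|h|h h' u].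
  - have [u] := B0 h; rewrite -{1}preB inE => uB.
    by exists (contract_proj xy u).
  - by apply/(conn_contract xy); rewrite preB.
  - by rewrite !inE; apply: Bi.
  - move=> h h' hh; rewrite (Ba _ _ hh); apply/idP/idP => /touchP.
      case=> u [v [uB vB]].
      case/(contract_proj_adj xy) => [e|uv].
        by case/eqP: hh; move: uB vB; rewrite (memB h) (memB h') e; apply: Bi.
      apply/touchP; exists (contract_proj xy u), (contract_proj xy v).
      by rewrite !inE -!memB.
    case=> u [v [uB vB /(contract_adjE xy)[u' [v' [eu ev uv]]]]].
    apply/touchP; exists u', v'.
    by rewrite (memB h) (memB h') eu ev; move: uB vB; rewrite !inE.
have Bs h x y : x \in B h -> y \in B h -> x = y.
  (* Without inner edges every predicate is locally constant on [B h], in particular [pred1 x]. *)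
  move=> xB yB; have := Bc h (pred1 x) _ x y xB yB.
  rewrite /= eqxx => e; apply/esym/eqP; rewrite -e // => u v uB vB uv.
  have /= := noe (u, v); rewrite uv /= => /negbT.
  by rewrite negb_exists => /forallP/(_ h); rewrite uB vB.
have [f fP] := fin_all_exists cov.
have [g gP] := fin_all_exists B0.
apply: induced_minor_iso; exists f.
  by exists g => [x|h]; [apply: Bs (gP _) (fP x)|apply: Bi (fP _) (gP h)].
move=> u v; have [e|ne] := eqVneq (f u) (f v).
  have -> : u = v by apply: Bs (fP u) _; rewrite e.
  by rewrite !adj_irr.
rewrite Ba //; apply/touchP/idP => [[u' [v' [uB vB]]]|uv].
  by rewrite (Bs _ _ _ uB (fP u)) (Bs _ _ _ vB (fP v)).
by exists u, v.
Qed.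

Lemma induced_minor_minor (H G : sgraph) : induced_minor H G -> minor H G.
Proof.
elim=> {G} [G GH|G x _|G x y xy _]; first exact: minor_iso.
  exact: minor_del_vertex.
exact: minor_contract.
Qed.

(** * The quotient by a packing *)

Section Quotient.
Variables (T : finType) (G : sgraph) (B : T -> {set G}).

Definition quotient_rel : rel T := fun h h' => (h != h') && touch (B h) (B h').
Fact quotient_sym : symmetric quotient_rel.
Proof. by move=> h h'; rewrite /quotient_rel eq_sym touch_sym. Qed.
Fact quotient_irr : irreflexive quotient_rel.
Proof. by move=> h; rewrite /quotient_rel eqxx. Qed.
Definition quotient : sgraph := SGraph quotient_sym quotient_irr.

(** A predicate locally constant on the union is constant on each connected [B w], so it descends to
    the quotient, where [C h] is connected. *)
Lemma imodel_quotient (H : sgraph) (C : H -> {set quotient}) :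
  packing B -> imodel C -> imodel (fun h => \bigcup_(w in C h) B w).
Proof.
case=> B0 Bc Bi [[C0 Cc Ci] Ca].
have ex h u : u \in \bigcup_(w in C h) B w -> exists2 w, w \in C h & u \in B w.
  by case/bigcupP=> w; exists w.
split; first split=> [h|h P loc|h h' u].
- have [w wC] := C0 h; have [u uB] := B0 w.
  by exists u; apply/bigcupP; exists w.
- have PB w : w \in C h -> {in B w &, forall u v, P u = P v}.
    move=> wC; apply: Bc => u v uB vB.
    by apply: loc; apply/bigcupP; exists w.
  pose P' (w : quotient) := [forall u in B w, P u].
  have P'E u w : w \in C h -> u \in B w -> P' w = P u.
    move=> wC uB; apply/forall_inP/idP => [/(_ _ uB) //|Pu v vB].
    by rewrite -(PB w wC u v).
  move=> u v /ex[w wC uB] /ex[w' wC' vB].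
  rewrite -(P'E u w) // -(P'E v w') //.
  apply: (Cc h) => // {w w' wC wC' uB vB u v} w w' wC wC'.
  case/andP=> _ /touchP[u [v [uB vB uv]]].
  rewrite (P'E u) // (P'E v) //; apply: loc uv; apply/bigcupP.
    by exists w.
  by exists w'.
- move=> /ex[w wC uB] /ex[w' wC']; move/(Bi _ _ _ uB) => e.
  by apply: Ci wC _; rewrite e.
- move=> h h' hh; rewrite (Ca _ _ hh); apply/touchP/touchP.
    case=> w [w' [wC wC' /andP[_ /touchP[u [v [uB vB uv]]]]]].
    exists u, v; split=> //; apply/bigcupP; first by exists w.
    by exists w'.
  case=> u [v [/ex[w wC uB] /ex[w' wC' vB] uv]].
  exists w, w'; split=> //; apply/andP; split.
    by apply: contraNneq hh => e; apply/eqP; apply: Ci wC _; rewrite e.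
  by apply/touchP; exists u, v.
Qed.

End Quotient.

(** * Connectivity along lines of cells *)

Lemma connU (G : sgraph) (A C : {set G}) :
  conn A -> conn C -> touch A C -> conn (A :|: C).
Proof.
move=> cA cC /touchP[a [c [aA cC' ac]]] P loc.
have Pa u : u \in A :|: C -> P u = P a.
  case/setUP=> uS.
    by apply: cA => // x y xA yA; apply: loc; rewrite inE (xA, yA).
  rewrite (loc a c) ?inE ?aA ?cC' ?orbT //.
  by apply: cC => // x y xA yA; apply: loc; rewrite inE (xA, yA) orbT.
by move=> x y xS yS; rewrite !Pa.
Qed.

(** Only unit steps are used, as no other edges of the host graph are guaranteed. Natural number
    coordinates leave membership conditions to linear arithmetic. *)
Definition cells_conn (f : nat -> nat -> bool) : Prop :=
  forall p : nat -> nat -> bool,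
    (forall r s, f r s -> f r.+1 s -> p r s = p r.+1 s) ->
    (forall r s, f r s -> f r s.+1 -> p r s = p r s.+1) ->
  forall r s r' s', f r s -> f r' s' -> p r s = p r' s'.

Lemma eq_on_interval (g p : pred nat) (a b : nat) :
  (forall x, g x -> g x.+1 -> p x = p x.+1) ->
  (forall x, minn a b <= x <= maxn a b -> g x) -> p a = p b.
Proof.
move=> pS; wlog ab : a b / a <= b => [wl|] gP.
  case: (leqP a b) => ab; first exact: wl.
  by apply/esym/wl; [lia|move=> x xab; apply: gP; lia].
elim: b ab gP => [|b IH] ab gP; first by congr p; lia.
case: (ltnP b a) => ba; first by congr p; lia.
rewrite IH //; first by apply: pS; apply: gP; lia.
by move=> x xab; apply: gP; lia.
Qed.

(** The grid is only a spanning subgraph: [Q] may have further edges, and [pt] is arbitrary outside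
    the range. *)
Record gridded (n : nat) (Q : sgraph) (pt : nat -> nat -> Q)
    (row col : Q -> nat) : Prop := Gridded {
  gridded_row : forall i j, i < n -> j < n -> row (pt i j) = i;
  gridded_col : forall i j, i < n -> j < n -> col (pt i j) = j;
  gridded_pt : forall v, pt (row v) (col v) = v;
  gridded_rowlt : forall v, row v < n;
  gridded_collt : forall v, col v < n;
  gridded_adjr : forall i j, i.+1 < n -> j < n -> adj (pt i j) (pt i.+1 j);
  gridded_adjc : forall i j, i < n -> j.+1 < n -> adj (pt i j) (pt i j.+1) }.

Lemma gridded_tr n (Q : sgraph) (pt : nat -> nat -> Q) row col :
  gridded n pt row col -> gridded n (fun i j => pt j i) col row.
Proof. by case=> *; split; auto. Qed.

(** * Crossings and small grids inside one block *)

Section Block.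
Variables (n : nat) (Q : sgraph) (pt : nat -> nat -> Q) (row col : Q -> nat).
Hypothesis gQ : gridded n pt row col.

Definition cells (f : nat -> nat -> bool) : {set Q} :=
  [set v | f (row v) (col v)].

Lemma mem_cells f r s : r < n -> s < n -> (pt r s \in cells f) = f r s.
Proof. by move=> rn sn; rewrite inE (gridded_row gQ) ?(gridded_col gQ). Qed.

Lemma conn_cells (f : nat -> nat -> bool) :
  (forall r s, f r s -> (r < n) && (s < n)) ->
  cells_conn f -> conn (cells f).
Proof.
move=> fn cf P loc u v; rewrite !inE => uf vf.
rewrite -(gridded_pt gQ u) -(gridded_pt gQ v).
apply: (cf (fun r s => P (pt r s))) => // r s /[dup] /fn/andP[rn sn] frs
  /[dup] /fn/andP[rn' sn'] frs'; apply: loc; rewrite ?mem_cells //.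
  exact: (gridded_adjr gQ).
exact: (gridded_adjc gQ).
Qed.

Lemma touch_cellsr (f g : nat -> nat -> bool) r s :
  r.+1 < n -> s < n -> f r s -> g r.+1 s ->
  touch (cells f) (cells g).
Proof.
move=> rn sn frs grs; apply/touchP; exists (pt r s), (pt r.+1 s).
by rewrite !mem_cells ?(ltnW rn) //; split => //; apply: (gridded_adjr gQ).
Qed.

Lemma touch_cellsc (f g : nat -> nat -> bool) r s :
  r < n -> s.+1 < n -> f r s -> g r s.+1 ->
  touch (cells f) (cells g).
Proof.
move=> rn sn frs grs; apply/touchP; exists (pt r s), (pt r s.+1).
by rewrite !mem_cells ?(ltnW sn) //; split => //; apply: (gridded_adjc gQ).
Qed.

Variables (k R0 C0 : nat).

Definition interior (v : Q) : bool :=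
  (R0 < row v < R0 + 2 * k) && (C0 < col v < C0 + 2 * k).

(** The connections end at the midpoints of the four sides, so that those of consecutive blocks in a
    strip are joined by a grid edge. *)
Record crossing (H V : {set Q}) : Prop := Crossing {
  crossing_connH : conn H;
  crossing_connV : conn V;
  crossing_disj : forall v, v \in H -> v \in V -> False;
  crossing_touch : touch H V;
  crossing_block : forall v, v \in H :|: V ->
    (R0 <= row v <= R0 + 2 * k) && (C0 <= col v <= C0 + 2 * k);
  crossing_left : pt (R0 + k) C0 \in H;
  crossing_right : pt (R0 + k) (C0 + 2 * k) \in H;
  crossing_top : pt R0 (C0 + k) \in V;
  crossing_bottom : pt (R0 + 2 * k) (C0 + k) \in V }.

Hypotheses (R0n : R0 + 2 * k < n) (C0n : C0 + 2 * k < n).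

(** Column [b.+1] lies strictly between the ends of the jump: the row segment of [f1] stops at [b],
    that of [f2] starts at [d], and only the edge [uv] bridges them. The parts of [f1] and [f2] on
    the margin avoid the corners and hence the margin rows of [g]. *)
Lemma col_jump_crossing (u v : Q) : interior u -> interior v -> adj u v ->
  (col u).+1 < col v -> exists H V, crossing H V.
Proof.
rewrite /interior => ui vi uv cuv.
pose a := row u; pose b := col u; pose c := row v; pose d := col v.
pose f1 r s := ((s == C0) && (R0 < r < R0 + 2 * k))
  || ((r == a) && (C0 <= s <= b)).
pose f2 r s := ((s == C0 + 2 * k) && (R0 < r < R0 + 2 * k))
  || ((r == c) && (d <= s <= C0 + 2 * k)).
pose g r s := [|| (r == R0) && (C0 < s < C0 + 2 * k),
  (s == b.+1) && (R0 <= r <= R0 + 2 * k)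
  | (r == R0 + 2 * k) && (C0 < s < C0 + 2 * k)].
rewrite -/a -/b -/c -/d in ui vi cuv.
exists (cells f1 :|: cells f2), (cells g); split.
- apply: connU.
  + apply: conn_cells => [r s|p pr pc r s r' s']; first by rewrite /f1; lia.
    (* Each cell is walked along its column to row [a], then along that row to [(a, b)]. *)
    have p1 x y : f1 x y -> p x y = p a b.
      move=> fxy; transitivity (p a y).
        apply: (eq_on_interval (g := f1^~ y) (p := p^~ y))
          => [z|z]; first exact: pr.
        by move: fxy; rewrite /f1; lia.
      apply: (eq_on_interval (g := f1 a) (p := p a)) => [z|z]; first exact: pc.
      by move: fxy; rewrite /f1; lia.
    by move=> f1rs f1rs'; rewrite !p1.
  + apply: conn_cells => [r s|p pr pc r s r' s']; first by rewrite /f2; lia.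
    have p1 x y : f2 x y -> p x y = p c d.
      move=> fxy; transitivity (p c y).
        apply: (eq_on_interval (g := f2^~ y) (p := p^~ y))
          => [z|z]; first exact: pr.
        by move: fxy; rewrite /f2; lia.
      apply: (eq_on_interval (g := f2 c) (p := p c)) => [z|z]; first exact: pc.
      by move: fxy; rewrite /f2; lia.
    by move=> f2rs f2rs'; rewrite !p1.
  + apply/touchP; exists u, v.
    by rewrite !inE /f1 /f2 -/a -/b -/c -/d; split=> //; lia.
- apply: conn_cells => [r s|p pr pc r s r' s']; first by rewrite /g; lia.
  have p1 x y : g x y -> p x y = p a b.+1.
    move=> fxy; transitivity (p x b.+1).
      apply: (eq_on_interval (g := g x) (p := p x)) => [z|z]; first exact: pc.
      by move: fxy; rewrite /g; lia.
    apply: (eq_on_interval (g := g^~ b.+1) (p := p^~ b.+1))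
      => [z|z]; first exact: pr.
    by move: fxy; rewrite /g; lia.
  by move=> grs grs'; rewrite !p1.
- by move=> w; rewrite !inE /f1 /f2 /g; lia.
- apply/touchP; exists (pt a b), (pt a b.+1).
  rewrite inE !mem_cells; try lia.
  by rewrite /f1 /g; split; [lia|lia|apply: (gridded_adjc gQ); lia].
- by move=> w; rewrite !inE /f1 /f2 /g; lia.
- rewrite inE !mem_cells /f1; lia.
- rewrite inE !mem_cells /f2; lia.
- rewrite mem_cells /g; lia.
- rewrite mem_cells /g; lia.
Qed.

(* The branch set of the vertex (x, y): the 3-path centred at the cell
   (2x+1, 2y+1) of the block, cut down to the interior because nothing is
   known about the edges at the margin. *)
Definition pinwheel (x y r s : nat) : bool :=
  [&& R0 < r < R0 + 2 * k, C0 < s < C0 + 2 * k &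
   odd (x + y) && (r == R0 + 2 * x + 1) && (C0 + 2 * y <= s <= C0 + 2 * y + 2)
   || ~~ odd (x + y) && (s == C0 + 2 * y + 1)
      && (R0 + 2 * x <= r <= R0 + 2 * x + 2)].

(** Paths of grid neighbours are perpendicular, an end of one next to the centre of the other. Paths
    of diagonal neighbours are parallel, on lines two apart; indices differing by at least 2 in a
    coordinate put the paths at least 2 apart there. Short edges therefore join only grid
    neighbours. *)
Lemma pinwheel_imodel :
  (forall u v, interior u -> interior v -> adj u v ->
     (row v <= (row u).+1) && (col v <= (col u).+1)) ->
  imodel (fun h : grid k k => cells (pinwheel h.1 h.2)).
Proof.
move=> short; split; first split.
- move=> [x y] /=; have := ltn_ord x; have := ltn_ord y => yk xk.
  exists (pt (R0 + 2 * x + 1) (C0 + 2 * y + 1)).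
  by rewrite mem_cells /pinwheel; lia.
- move=> [x y] /=; have := ltn_ord x; have := ltn_ord y => yk xk.
  apply: conn_cells => [r s|p pr pc r s r' s']; first by rewrite /pinwheel; lia.
  have p1 i j : pinwheel x y i j -> p i j = p (R0 + 2 * x + 1) (C0 + 2 * y + 1).
    move=> fij; transitivity (p i (C0 + 2 * y + 1)).
      apply: (eq_on_interval (g := pinwheel x y i) (p := p i))
        => [z|z]; first exact: pc.
      by move: fij; rewrite /pinwheel; lia.
    apply: (eq_on_interval (g := (pinwheel x y)^~ (C0 + 2 * y + 1))
      (p := p^~ (C0 + 2 * y + 1))) => [z|z]; first exact: pr.
    by move: fij; rewrite /pinwheel; lia.
  by move=> grs grs'; rewrite !p1.
- move=> [x y] [x' y'] v; rewrite !inE /pinwheel /= => h h'.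
  by congr (_, _); apply: val_inj => /=; lia.
- have gridP (h h' : grid k k) : adj h h' ->
      touch (cells (pinwheel h.1 h.2)) (cells (pinwheel h'.1 h'.2)).
    have key (x y : nat) : x < k -> y < k ->
       (x.+1 < k -> touch (cells (pinwheel x y)) (cells (pinwheel x.+1 y))) /\
       (y.+1 < k -> touch (cells (pinwheel x y)) (cells (pinwheel x y.+1))).
      (* For odd [x + y] the path is horizontal: its centre meets the end of the path below, and its
         right end the centre of the next one. For even [x + y] the roles are exchanged. *)
      move=> xk yk; case e: (odd (x + y)); split=> lt.
      + by apply: (@touch_cellsr _ _ (R0 + 2 * x + 1) (C0 + 2 * y + 1));
          rewrite /pinwheel; lia.
      + by apply: (@touch_cellsc _ _ (R0 + 2 * x + 1) (C0 + 2 * y + 2));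
          rewrite /pinwheel; lia.
      + by apply: (@touch_cellsr _ _ (R0 + 2 * x + 2) (C0 + 2 * y + 1));
          rewrite /pinwheel; lia.
      + by apply: (@touch_cellsc _ _ (R0 + 2 * x + 1) (C0 + 2 * y + 1));
          rewrite /pinwheel; lia.
    case: h h' => [x y] [x' y'] /=; rewrite /grid_rel /=.
    have := (ltn_ord x, ltn_ord y, ltn_ord x', ltn_ord y').
    case=> -[[xk yk] xk' yk'].
    have [[kr kc] [kr' kc']] := (key x y xk yk, key x' y' xk' yk').
    case/orP=> /andP[/eqP e d].
      have {}e : nat_of_ord x = x' by rewrite e.
      have [e'|e'] : nat_of_ord y' = y.+1 \/ nat_of_ord y = y'.+1 by lia.
        by rewrite e' -e; apply: kc; lia.
      by rewrite touch_sym e' e; apply: kc'; lia.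
    have {}e : nat_of_ord y = y' by rewrite e.
    have [e'|e'] : nat_of_ord x' = x.+1 \/ nat_of_ord x = x'.+1 by lia.
      by rewrite e' -e; apply: kr; lia.
    by rewrite touch_sym e' e; apply: kr'; lia.
  move=> h h' hh; apply/idP/idP => [|/touchP[u [v [uh vh uv]]]].
    exact: gridP.
  move: uh vh; rewrite !inE => uh vh.
  have ui : interior u by move: uh; rewrite /pinwheel /interior; lia.
  have vi : interior v by move: vh; rewrite /pinwheel /interior; lia.
  have vu : adj v u by rewrite adj_sym.
  (* [short] bounds the coordinates from one side only, so it is used in both directions. *)
  have := short u v ui vi uv; have := short v u vi ui vu.
  case: h h' hh uh vh => [x y] [x' y'] hh /=.
  rewrite /pinwheel /grid_rel /= => uh vh.
  have {}hh : nat_of_ord x <> x' \/ nat_of_ord y <> y'.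
    case: (x =P x') => [e|ne]; last by left => /val_inj.
    by right=> /val_inj e'; case/eqP: hh; rewrite e e'.
  rewrite -!val_eqE /=; lia.
Qed.

End Block.

(** Transposition turns a row jump into a column jump and exchanges the two connections. *)
Lemma row_jump_crossing n (Q : sgraph) (pt : nat -> nat -> Q) row col
    (k R0 C0 : nat) (u v : Q) : gridded n pt row col ->
  R0 + 2 * k < n -> C0 + 2 * k < n ->
  interior row col k R0 C0 u -> interior row col k R0 C0 v -> adj u v ->
  (row u).+1 < row v -> exists H V, crossing pt row col k R0 C0 H V.
Proof.
move=> gQ Rn Cn ui vi uv ruv.
have sw w : interior row col k R0 C0 w -> interior col row k C0 R0 w.
  by rewrite /interior andbC.
have [V [H [cV cH d /touchP t b vl vr vt vb]]] :=
  col_jump_crossing (gridded_tr gQ) Cn Rn (sw u ui) (sw v vi) uv ruv.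
exists H, V; split=> //; first by move=> w wH wV; apply: d wV wH.
  by rewrite touch_sym; apply/touchP.
by move=> w; rewrite setUC andbC; apply: b.
Qed.

(** * Assembling the blocks *)

Section Blocks.
Variables (n k t : nat) (Q : sgraph).
Variables (pt : nat -> nat -> Q) (row col : Q -> nat).
Hypothesis gQ : gridded n pt row col.
Local Notation m := (2 * k + 1).

Lemma block_index (i r : nat) : i * m <= r <= i * m + 2 * k -> r %/ m = i.
Proof.
move=> h; have -> : r = i * m + (r - i * m) by lia.
by rewrite divnMDl ?divn_small; lia.
Qed.

(** The two strips of a branch set are joined in the diagonal block [(i, i)]; the branch sets of [i]
    and [i'] touch in block [(i, i')]. *)
Lemma crossings_imodel (H V : 'I_t -> 'I_t -> {set Q}) : t * m <= n ->
  (forall i j : 'I_t, crossing pt row col k (i * m) (j * m) (H i j) (V i j)) ->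
  imodel (fun i : complete t => \bigcup_j (H i j :|: V j i)).
Proof.
move=> tn cr.
have iP (i : 'I_t) : i * m + 2 * k < n.
  by have := leq_mul (ltn_ord i) (leqnn m); lia.
have inB (i : 'I_t) w : w \in \bigcup_j (H i j :|: V j i) ->
    (exists j, w \in H i j) \/ (exists j, w \in V j i).
  by case/bigcupP=> j _ /setUP[wH|wV]; [left|right]; exists j.
have HB (i j : 'I_t) w : w \in H i j -> w \in \bigcup_j (H i j :|: V j i).
  by move=> wH; apply/bigcupP; exists j; rewrite // inE wH.
have VB (i j : 'I_t) w : w \in V j i -> w \in \bigcup_j (H i j :|: V j i).
  by move=> wV; apply/bigcupP; exists j; rewrite // inE wV orbT.
have idx (i j : 'I_t) w : w \in H i j :|: V i j ->
      row w %/ m = i /\ col w %/ m = j.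
  case/(crossing_block (cr i j))/andP => rw cw.
    by rewrite !(@block_index _ _ rw, @block_index _ _ cw).
split; first split.
- move=> i; exists (pt (i * m + k) (i * m)); apply: (HB i i).
  exact: crossing_left (cr i i).
- move=> i P loc.
  have PH j : {in H i j &, forall x y, P x = P y}.
    apply: (crossing_connH (cr i j)) => x y /HB xB /HB yB.
    exact: loc.
  have PV j : {in V j i &, forall x y, P x = P y}.
    apply: (crossing_connV (cr j i)) => x y /VB xB /VB yB.
    exact: loc.
  (* The strip is walked leftwards: the left midpoint of a block is adjacent to the right midpoint
     of the preceding block. *)
  have chH (j : 'I_t) w : w \in H i j ->
      P w = P (pt (i * m + k) 0).
    move: j w; case=> j; elim: j => [|j IH] jt w wH.
      by rewrite (PH _ _ _ wH (crossing_left (cr i (Ordinal jt)))).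
    have jt' : j < t by lia.
    have h1 := crossing_left (cr i (Ordinal jt)).
    have h2 := crossing_right (cr i (Ordinal jt')).
    rewrite (PH _ _ _ wH h1) -(IH jt' _ h2); apply/esym/loc.
    + exact: HB h2.
    + exact: HB h1.
    + have -> : Ordinal jt * m = (Ordinal jt' * m + 2 * k).+1.
        by rewrite /=; lia.
      apply: (gridded_adjc gQ); first by have := iP i; lia.
      by have := iP (Ordinal jt); rewrite /=; lia.
  have chV (j : 'I_t) w : w \in V j i ->
      P w = P (pt 0 (i * m + k)).
    move: j w; case=> j; elim: j => [|j IH] jt w wV.
      by rewrite (PV _ _ _ wV (crossing_top (cr (Ordinal jt) i))).
    have jt' : j < t by lia.
    have h1 := crossing_top (cr (Ordinal jt) i).
    have h2 := crossing_bottom (cr (Ordinal jt') i).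
    rewrite (PV _ _ _ wV h1) -(IH jt' _ h2); apply/esym/loc.
    + exact: VB h2.
    + exact: VB h1.
    + have -> : Ordinal jt * m = (Ordinal jt' * m + 2 * k).+1.
        by rewrite /=; lia.
      apply: (gridded_adjr gQ); last by have := iP i; lia.
      by have := iP (Ordinal jt); rewrite /=; lia.
  have Pc w : w \in \bigcup_j (H i j :|: V j i) -> P w = P (pt (i * m + k) 0).
    case/inB=> -[j wj]; first exact: chH wj.
    have /touchP[x [y [xH yV xy]]] := crossing_touch (cr i i).
    rewrite (chV j) // -(chV i y) // -(chH i x) //; apply/esym/loc => //.
      exact: HB xH.
    exact: VB yV.
  by move=> x y xB yB; rewrite !Pc.
- move=> i i' w /inB[[j wj]|[j wj]] /inB[[j' wj']|[j' wj']].
  + have [|e _] := @idx i j w; first by rewrite inE wj.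
    have [|e' _] := @idx i' j' w; first by rewrite inE wj'.
    by apply: val_inj; rewrite /= -e -e'.
  (* A horizontal and a vertical piece sharing a vertex lie in the same block, where they are
     disjoint. *)
  + have [|e f] := @idx i j w; first by rewrite inE wj.
    have [|e' f'] := @idx j' i' w; first by rewrite inE wj' orbT.
    have ej : i = j' by apply: val_inj; rewrite /= -e -e'.
    have ei : j = i' by apply: val_inj; rewrite /= -f -f'.
    by subst; case: (crossing_disj (cr _ _) wj wj').
  + have [|e f] := @idx j i w; first by rewrite inE wj orbT.
    have [|e' f'] := @idx i' j' w; first by rewrite inE wj'.
    have ej : j = i' by apply: val_inj; rewrite /= -e -e'.
    have ei : i = j' by apply: val_inj; rewrite /= -f -f'.
    by subst; case: (crossing_disj (cr _ _) wj' wj).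
  + have [|_ e] := @idx j i w; first by rewrite inE wj orbT.
    have [|_ e'] := @idx j' i' w; first by rewrite inE wj' orbT.
    by apply: val_inj; rewrite /= -e -e'.
- move=> i i' ii'; rewrite /adj /= /complete_rel ii'; apply/esym/touchP.
  have /touchP[x [y [xH yV xy]]] := crossing_touch (cr i i').
  by exists x, y; split=> //; [apply: HB xH|apply: VB yV].
Qed.

Lemma grid_or_complete_imodel : t * m <= n ->
  (exists B : grid k k -> {set Q}, imodel B) \/
  (exists B : complete t -> {set Q}, imodel B).
Proof.
move=> tn.
have iP (i : 'I_t) : i * m + 2 * k < n.
  by have := leq_mul (ltn_ord i) (leqnn m); lia.
pose jump (i j : 'I_t) (u v : Q) :=
  [&& interior row col k (i * m) (j * m) u,
      interior row col k (i * m) (j * m) v,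
      adj u v & ((row u).+1 < row v) || ((col u).+1 < col v)].
case: (pickP (fun p : 'I_t * 'I_t =>
  [forall u, forall v, ~~ jump p.1 p.2 u v])).
  move=> [i j] /= /forallP nj; left.
  exists (fun h : grid k k =>
    cells row col (pinwheel k (i * m) (j * m) h.1 h.2)).
  apply: (pinwheel_imodel gQ (iP i) (iP j)) => u v ui vi uv.
  have /forallP/(_ v) := nj u.
  by rewrite /jump ui vi uv /= negb_or -!leqNgt.
move=> alljump; right.
have cr (p : 'I_t * 'I_t) : exists HV : {set Q} * {set Q},
    crossing pt row col k (p.1 * m) (p.2 * m) HV.1 HV.2.
  have /negbT := alljump p; rewrite negb_forall => /existsP[u].
  rewrite negb_forall => /existsP[v]; rewrite negbK => /and4P[ui vi uv].
  case/orP=> [ruv|cuv].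
    have [H [V HV]] := row_jump_crossing gQ (iP p.1) (iP p.2) ui vi uv ruv.
    by exists (H, V).
  have [H [V HV]] := col_jump_crossing gQ (iP p.1) (iP p.2) ui vi uv cuv.
  by exists (H, V).
have [HV HVP] := fin_all_exists cr.
exists (fun i => \bigcup_j ((HV (i, j)).1 :|: (HV (j, i)).2)).
apply: (crossings_imodel (H := fun i j => (HV (i, j)).1)
  (V := fun i j => (HV (i, j)).2)) => // i j.
exact: (HVP (i, j)).
Qed.

End Blocks.

(** * From the given grid minor to the conclusion *)

Lemma grid_quotient_gridded n (G : sgraph)
    (B : 'I_n.+1 * 'I_n.+1 -> {set G}) :
  (forall h h', @grid_rel n.+1 n.+1 h h' -> touch (B h) (B h')) ->
  @gridded n.+1 (quotient B) (fun i j => (inord i, inord j))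
    (fun v => v.1) (fun v => v.2).
Proof.
move=> Be; split=> [i j ik jk|i j ik jk|[i j]|v|v|i j ik jk|i j ik jk] /=;
  rewrite ?inordK ?inord_val //;
  set h := (_, _); set h' := (_, _);
  (have hh : grid_rel h h' by
    rewrite /grid_rel /h /h' /= !inordK ?eqxx ?(ltnW ik) ?(ltnW jk) //; lia);
  rewrite /adj /= /quotient_rel (Be _ _ hh) andbT;
  by apply: contraTneq hh => ->; rewrite grid_irr.
Qed.

Theorem theorem17 (k t : nat) (G : sgraph) :
  minor (grid (t * (2 * k + 1)) (t * (2 * k + 1))) G ->
  induced_minor (grid k k) G \/ minor (complete t) G.
Proof.
(* The graph [complete 0] has no vertices, so the empty family models it in every graph. *)
case: t => [_|t].
  right; apply: induced_minor_minor.
  apply: (@imodel_induced_minor _ _ (fun=> set0)).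
  by split; first split; case.
(* The side length is put in successor form, since [inord] has values in ['I_n.+1]. *)
have [n en] : exists n, t.+1 * (2 * k + 1) = n.+1.
  by exists (t.+1 * (2 * k + 1)).-1; lia.
rewrite en => /minor_packing[B pB Be].
have gQ := grid_quotient_gridded Be.
have [|[C mC]|[C mC]] := @grid_or_complete_imodel n.+1 k t.+1 _ _ _ _ gQ.
- by rewrite en.
- by left; apply: imodel_induced_minor (imodel_quotient pB mC).
- right; apply: induced_minor_minor.
  exact: imodel_induced_minor (imodel_quotient pB mC).
Qed.
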